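(* Let $\mathcal{M}$ be a three dimensional contact manifold with Darboux coordinates $(x,y,z)$, contact form $\sigma=x\,dy+dz$ and volume form $d\mu=d\sigma\wedge\sigma$. Then the Hamiltonian operator of the Lie--Poisson bracket $\{\mathfrak{H},\mathfrak{K}\}(L)=\int_{\mathcal{M}}L\,\{\delta\mathfrak{H}/\delta L,\delta\mathfrak{K}/\delta L\}_c\,d\mu$ on the space $Den(\mathcal{M})$ of densities $L\,d\mu$ is $$J_{LP}(L)=X_L+4L\frac{\partial}{\partial z}+\frac{\partial L}{\partial z},$$ the last term being the multiplication operator by $\partial L/\partial z$; that is, for smooth functions $H,K,L$, $$\int_{\mathcal{M}}L\{H,K\}_c\,d\mu=\int_{\mathcal{M}}H\,J_{LP}(L)K\,d\mu.$$ Moreover, with $\delta\mathfrak{K}/\delta L=K$, the Lie--Poisson equation $\dot L=-ad^*_KL$ on $Den(\mathcal{M})$ is $$\dot L=-\{L,K\}_c-2\,div_{d\mu}(X_K)\,L .$$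
   Context: For a smooth function $K=K(x,y,z)$ the contact vector field is $$X_K=\Big(\frac{\partial K}{\partial y}-x\frac{\partial K}{\partial z}\Big)\frac{\partial}{\partial x}-\frac{\partial K}{\partial x}\frac{\partial}{\partial y}+\Big(-K+x\frac{\partial K}{\partial x}\Big)\frac{\partial}{\partial z},$$ and $div_{d\mu}X_K$ is defined by $\mathcal{L}_{X_K}d\mu=(div_{d\mu}X_K)d\mu$. The contact Poisson (Lagrange) bracket of functions is $$\{L,K\}_c=\frac{\partial L}{\partial x}\frac{\partial K}{\partial y}-\frac{\partial L}{\partial y}\frac{\partial K}{\partial x}+\frac{\partial K}{\partial z}\Big(L-x\frac{\partial L}{\partial x}\Big)-\frac{\partial L}{\partial z}\Big(K-x\frac{\partial K}{\partial x}\Big).$$ The space $Den(\mathcal{M})$, whose elements $L\,d\mu$ are identified with functions $L$, is dual to the Lie algebra $(\mathcal{F}(\mathcal{M}),\{\ ,\ \}_c)$ by $\langle L,H\rangle=\int_{\mathcal{M}}LH\,d\mu$. The coadjoint action is defined by $\langle ad^*_KL,H\rangle=\langle L,\{K,H\}_c\rangle$ for all $H$. Functional derivatives of functionals of $L$ are functions on $\mathcal{M}$. Everything is expressed in the Darboux chart, and boundary terms in integrations by parts are assumed to vanish (e.g. the integrands are compactly supported in the chart). *)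

(* Defs.v *)
From mathcomp Require Import all_boot all_order all_algebra.
From mathcomp Require Import all_classical all_reals all_analysis.

Set Implicit Arguments.
Unset Strict Implicit.
Unset Printing Implicit Defensive.

Import Order.TTheory GRing.Theory Num.Theory.
Import numFieldNormedType.Exports.

Local Open Scope classical_set_scope.
Local Open Scope ring_scope.

(** The manifold is read in its Darboux chart (x, y, z): it is an open set [U]
    of R^3.  A function (density, vector field, ...) on the manifold is
    represented by a total function on R^3; its values outside [U] are
    irrelevant. *)


Section Chart.
Context {R : realType}.
Local Notation E := ((R * R) * R)%type.
Implicit Types (U : set E) (f g H K L A : E -> R) (X : E -> E) (p u v w : E).

Definition cx p : R := p.1.1.
Definition cy p : R := p.1.2.
Definition cz p : R := p.2.

Definition e_x : E := ((1, 0), 0).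
Definition e_y : E := ((0, 1), 0).
Definition e_z : E := ((0, 0), 1).

Definition dx f p : R := 'D_e_x f p.
Definition dy f p : R := 'D_e_y f p.
Definition dz f p : R := 'D_e_z f p.

(** A vector field acting as a derivation on functions. *)
Definition vfapp X f p : R := 'D_(X p) f p.

(** C^oo on the open set [U]: every iterated partial derivative, including [f]
    itself, is (Frechet) differentiable at every point of [U]. *)
Definition partial (i : 'I_3) f : E -> R :=
  if i == 0%N :> nat then dx f else if i == 1%N :> nat then dy f else dz f.

Definition smooth_on U f :=
  forall (s : seq 'I_3) p, U p -> differentiable (foldr partial f s) p.

(** Support relative to [U]. *)
Definition supp_in U f : set E := U `&` closure (U `&` [set p | f p != 0]).

Definition test_fun U f := smooth_on U f /\ compact (supp_in U f).

(** ** Differential forms: a k-form sends a point and k vectors to a scalar. *)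

Definition dform1 (a : E -> E -> R) : E -> E -> E -> R :=
  fun p u v => 'D_u (a ^~ v) p - 'D_v (a ^~ u) p.

Definition wedge21 (b : E -> E -> E -> R) (a : E -> E -> R) :
    E -> E -> E -> E -> R :=
  fun p u v w => b p u v * a p w + b p v w * a p u + b p w u * a p v.

(** Lie derivative of a 3-form, evaluated on constant vector fields [u], [v],
    [w], for which [X, u] = - D_u X. *)
Definition Lie3 X (o : E -> E -> E -> E -> R) : E -> E -> E -> E -> R :=
  fun p u v w =>
    'D_(X p) (fun q => o q u v w) p
    + o p ('D_u X p) v w + o p u ('D_v X p) w + o p u v ('D_w X p).

(** sigma = x dy + dz *)
Definition sigma : E -> E -> R := fun p u => cx p * cy u + cz u.

Definition dmu : E -> E -> E -> E -> R := wedge21 (dform1 sigma) sigma.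

(** The number c such that L_X dmu = c dmu at [p]. *)
Definition div_dmu X p : R :=
  get [set c : R | forall u v w, Lie3 X dmu p u v w = c * dmu p u v w].

(** Integral over [U] of the 3-form f dmu, i.e. of its component on
    dx /\ dy /\ dz against Lebesgue measure. *)
Definition leb3 :=
  ((@lebesgue_measure R \x @lebesgue_measure R) \x @lebesgue_measure R)%E.

Definition int_dmu U f : R := \int[leb3]_(p in U) (f p * dmu p e_x e_y e_z).

Definition contact_vf K : E -> E := fun p =>
  ((dy K p - cx p * dz K p, - dx K p), - K p + cx p * dx K p).

Definition bracket_c L K : E -> R := fun p =>
  dx L p * dy K p - dy L p * dx K p
  + dz K p * (L p - cx p * dx L p) - dz L p * (K p - cx p * dx K p).

Definition J_LP L : (E -> R) -> E -> R := fun K p =>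
  vfapp (contact_vf L) K p + 4 * L p * dz K p + dz L p * K p.

Definition pairing U L H : R := int_dmu U (fun p => L p * H p).

(** [A] = ad^*_K L; the vectors [H] are tested among compactly supported
    functions, so that no boundary terms appear. *)
Definition is_coad U K L A :=
  smooth_on U A /\
  forall H, test_fun U H -> pairing U A H = pairing U L (bracket_c K H).

Definition coad U K L : E -> R := get [set A | is_coad U K L A].

(** [K] = delta F / delta L, for variations compactly supported in [U]. *)
Definition is_fderiv U (F : (E -> R) -> R) L K :=
  smooth_on U K /\
  forall f, test_fun U f ->
    is_derive (0 : R) 1 (fun e : R => F (fun p => L p + e * f p))
      (pairing U K f).

Definition fderiv U (F : (E -> R) -> R) L : E -> R :=
  get [set K | is_fderiv U F L K].

Definition LP_bracket U (F G : (E -> R) -> R) L : R :=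
  pairing U L (bracket_c (fderiv U F L) (fderiv U G L)).

End Chart.

(* Main.v *)
From HB Require Import structures.
Require Import Defs.
From mathcomp Require Import all_boot all_order all_algebra.
From mathcomp Require Import all_classical all_reals all_analysis.
From mathcomp Require Import measurable_realfun.
From mathcomp Require Import ring lra.

Set Implicit Arguments.
Unset Strict Implicit.
Unset Printing Implicit Defensive.

Import Order.TTheory GRing.Theory Num.Theory.
Import numFieldNormedType.Exports.

Local Open Scope classical_set_scope.
Local Open Scope ring_scope.

(** [J_LP L K] is obtained from [L {H, K}_c] by integrating by parts. Writing
    [{H, K}_c = X_K H + K_z H], one has pointwise
    [L {H, K}_c - H J_LP(L) K = div (L H X_K)], where the only input is
    [div X_K = - 2 K_z], i.e. the symmetry of second derivatives. The field
    [L H X_K], extended by zero, is smooth with compact support in R^3, so its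
    divergence integrates to 0 by Fubini and the fundamental theorem of
    calculus. Since [J_LP(L) K = - ({L, K}_c + 2 div (X_K) L)], this also
    identifies [ad^*_K L]. Bump functions built from [exp (- 1 / t)] make the
    functional derivative and the coadjoint action unique. *)

(** * Smooth functions *)

(** The constant 4 in [J_LP] adds up as 2 + 1 + 1: moving [X_K] off [H] yields $-L H\,div X_K = 2 L
    H K_z$, the bracket itself carries the zero order term $L H K_z$, and antisymmetry rewrites
    $-X_K L$ as $X_L K + L_z K + K_z L$. The same 4 returns in the coadjoint formula as $2\,div X_K
    = -4 K_z$. Two features of the setting shape the rest. The chart [U] is an arbitrary open set
    and functions are total with irrelevant values outside it, so identities are transported through
    equality near a point, and integrals over [U] are reduced to R^3 by extension by zero. Moreover
    [div_dmu], [fderiv] and [coad] are picked by [get], so a formula for each takes existence and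
    uniqueness; for the last two, uniqueness holds on [U] only. *)

Section Flat.
Context {R : realType}.

(** The index [n] is there because differentiation raises it: the whole family is stable under
    derivation up to linear combinations, while [flat 0] alone is not. *)
Definition flat (n : nat) (t : R) : R :=
  if 0 < t then t^-1 ^+ n * expR (- t^-1) else 0.

Lemma flat_ge0 n t : 0 <= flat n t.
Proof.
rewrite /flat; case: ifPn => // t0.
by rewrite mulr_ge0 ?expR_ge0// exprn_ge0// invr_ge0 ltW.
Qed.

Lemma flat_gt0 n t : 0 < t -> 0 < flat n t.
Proof.
by move=> t0; rewrite /flat t0 mulr_gt0 ?expR_gt0// exprn_gt0// invr_gt0.
Qed.

Lemma flat_le0 n t : t <= 0 -> flat n t = 0.
Proof. by move=> t0; rewrite /flat ltNge t0. Qed.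

(** The term of degree [n + 2] of the exponential series bounds [expR t^-1] from below; inverting it
    leaves the factor [t ^+ 2]. Order two makes the derivative at 0 vanish. *)
Lemma flat_le_sqr n t : flat n t <= n.+2`!%:R * t ^+ 2.
Proof.
have [t0|t0] := leP t 0; first by rewrite flat_le0// mulr_ge0 ?sqr_ge0.
rewrite /flat t0 expRN.
have tn0 k : 0 < t^-1 ^+ k by rewrite exprn_gt0// invr_gt0.
have f0 : 0 < n.+2`!%:R :> R by rewrite ltr0n fact_gt0.
have le_exp : t^-1 ^+ n.+2 / n.+2`!%:R <= expR t^-1.
  by apply: le_trans (expR_ge1Dxn n.+1 _); rewrite ?lerDr// invr_ge0 ltW.
apply: (@le_trans _ _ (t^-1 ^+ n * (t^-1 ^+ n.+2 / n.+2`!%:R)^-1)).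
  by rewrite ler_pM2l// lef_pV2// posrE ?expR_gt0// divr_gt0.
have t_neq0 : t != 0 by rewrite gt_eqF.
rewrite le_eqVlt; apply/orP; left; apply/eqP.
rewrite -addn2 !exprVn exprD addn2; field.
by rewrite !t_neq0 expf_neq0// gt_eqF.
Qed.

Lemma is_derive_flat (n : nat) (t : R) :
  is_derive t (1 : R) (flat n) (flat n.+2 t - n%:R * flat n.+1 t).
Proof.
have [t0|t0|->] := ltgtP t 0.
- rewrite !flat_le0 ?ltW// mulr0 subr0.
  apply: (near_eq_is_derive (f := cst 0)) => //.
  by near=> s; rewrite flat_le0//; apply/ltW; near: s; exact: lt_nbhsl.
- have t_neq0 : t != 0 by rewrite gt_eqF.
  have dV : is_derive t 1 (fun s : R => s^-1) (- t ^- 2 *: 1).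
    exact: is_deriveV.
  have dE : is_derive t 1 (fun s : R => expR (- s^-1))
      (expR (- t^-1) * (- (- t ^- 2 *: 1))).
    exact: (is_derive1_comp (f := expR) (g := fun s => - s^-1)).
  have e : is_derive t 1
      (((fun s : R => s^-1) ^+ n) * (fun s : R => expR (- s^-1)))
      (flat n.+2 t - n%:R * flat n.+1 t).
    apply: is_derive_eq.
    rewrite /flat t0 !scalerAl /GRing.scale/= -!exprVn !mulr1.
    have -> : ((fun s : R => s^-1) ^+ n) t = t^-1 ^+ n.
      by elim: (n) => // k IH; rewrite !exprS -IH.
    case: n => [|n]; rewrite ?expr0 ?mul0r !exprS; ring.
  apply: near_eq_is_derive e.
  near=> s.
  rewrite /flat ifT; last by near: s; exact: lt_nbhsr.
  rewrite /GRing.mul/=; congr (_ * _).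
  by elim: (n) => // k IH; rewrite !exprS -IH.
(* At [t = 0] the quadratic bound makes the difference quotient at most a constant times [|h|]. *)
rewrite !flat_le0// mulr0 subr0.
suff c : h^-1 *: (flat n (h *: 1 + 0) - flat n 0) @[h --> 0^'] --> (0 : R).
  by apply: DeriveDef; [exact: cvgP c | exact/cvg_lim].
apply/cvgrPdist_le => e e0; near=> h.
have h0 : 0 < `|h| by rewrite normr_gt0; near: h; exact: nbhs_dnbhs_neq.
rewrite [_ *: 1]mulr1 addr0 (flat_le0 n (lexx 0)) subr0 sub0r normrN normrM.
rewrite normfV ler_pdivrMl// (ger0_norm (flat_ge0 _ _)).
apply: le_trans (flat_le_sqr _ _) _.
rewrite -(real_normK (num_real h)) expr2 mulrCA ler_pM2l//.
rewrite -ler_pdivlMl ?ltr0n ?fact_gt0//.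
near: h; apply: dnbhs0_le; by rewrite mulr_gt0// invr_gt0 ltr0n fact_gt0.
Unshelve. all: by end_near. Qed.

End Flat.

Lemma near_eq_diff {K : numFieldType} {V W : normedModType K} (f g : V -> W)
    (x : V) :
  (\near x, f x = g x) -> differentiable f x ->
  differentiable g x /\ 'd g x = 'd f x :> (V -> W).
Proof.
move=> fg df.
have gE : g \o shift x = cst (g x) + 'd f x +o_ (0 : V) id.
  have /eqaddoP fE := diff_locally df.
  apply/eqaddoP => e e0; move: (fE _ e0) => {}fE; near=> h.
  have -> : (g \o shift x - (cst (g x) + 'd f x)) h =
            (f \o shift x - (cst (f x) + 'd f x)) h.
    rewrite !fctE /= -(nbhs_singleton fg); congr (_ - _).
    apply/esym; near: h.
    by have := fg; rewrite (near_shift 0) subr0.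
  by near: h.
have dE : 'd g x = 'd f x :> (V -> W).
  by apply: diff_unique gE; exact: diff_continuous.
split=> //; apply/diff_locallyP; rewrite dE; split => //.
exact: diff_continuous.
Unshelve. all: by end_near. Qed.

Section Smooth.
Context {R : realType}.
Local Notation E := ((R * R) * R)%type.
Implicit Types (U : set E) (f g : E -> R) (p : E) (i : 'I_3).

Definition basis i : E :=
  if i == 0%N :> nat then e_x else if i == 1%N :> nat then e_y else e_z.

Lemma partialE i f p : partial i f p = 'D_(basis i) f p.
Proof. by rewrite /partial /basis; case: ifP => // _; case: ifP. Qed.

Lemma smooth_diff U f p : smooth_on U f -> U p -> differentiable f p.
Proof. by move=> sf Up; apply: (sf [::]). Qed.

Lemma smooth_partial U i f : smooth_on U f -> smooth_on U (partial i f).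
Proof. by move=> sf s p Up; have := sf (rcons s i) p Up; rewrite foldr_rcons. Qed.

(** [S] is an invariant: iterated partials never leave it, so only differentiability of its members
    has to be checked. *)
Lemma smooth_ind U (S : (E -> R) -> Prop) :
  (forall f, S f -> forall p, U p -> differentiable f p) ->
  (forall f i, S f -> S (partial i f)) ->
  forall f, S f -> smooth_on U f.
Proof.
move=> Sd Sp f Sf s p Up; apply: (Sd) (Up) => {p Up}.
by elim: s => //= i s IH; exact: Sp.
Qed.

Lemma near_open U f g p : open U -> U p -> {in U, f =1 g} ->
  \near p, f p = g p.
Proof.
move=> oU Up fg.
have : \forall q \near p, U q by exact: open_nbhs_nbhs.
by apply: filterS => q Uq; apply: fg; rewrite inE.
Qed.

Lemma eq_on_partial U f g i : open U -> {in U, f =1 g} ->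
  {in U, partial i f =1 partial i g}.
Proof.
move=> oU fg p; rewrite inE => Up; rewrite !partialE.
exact/near_eq_derive/(near_open oU).
Qed.

(** The closure under the ring operations and composition with [flat] of the
    functions smooth on [U]; it is stable under partial derivatives, hence
    contained in the smooth functions. *)
Inductive smooth_gen U : (E -> R) -> Prop :=
| sg_smooth f of smooth_on U f : smooth_gen U f
| sg_eq f g of smooth_gen U f & {in U, f =1 g} : smooth_gen U g
| sg_cst c : smooth_gen U (cst c)
| sg_add f g of smooth_gen U f & smooth_gen U g : smooth_gen U (f + g)
| sg_mul f g of smooth_gen U f & smooth_gen U g : smooth_gen U (f * g)
| sg_flat n f of smooth_gen U f : smooth_gen U (flat n \o f).

Lemma differentiable_flat n (t : R) : differentiable (flat n) t.
Proof. by apply/derivable1_diffP; have := is_derive_flat n t; case. Qed.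

Lemma smooth_gen_diff U f p : open U -> smooth_gen U f -> U p ->
  differentiable f p.
Proof.
move=> oU sf Up; elim: sf => {f}.
- by move=> f sf; exact: smooth_diff sf Up.
- by move=> f g _ df fg; case: (near_eq_diff (near_open oU Up fg) df).
- by move=> c; exact: differentiable_cst.
- by move=> f g _ df _ dg; exact: differentiableD.
- by move=> f g _ df _ dg; exact: differentiableM.
- by move=> n f _ df; apply: differentiable_comp => //; exact: differentiable_flat.
Qed.

Lemma derive_flat_comp n f p v : differentiable f p ->
  'D_v (flat n \o f) p =
  (flat n.+2 (f p) - n%:R * flat n.+1 (f p)) * 'D_v f p.
Proof.
move=> df; have dF := differentiable_flat n (f p).
rewrite !deriveE//; last exact: differentiable_comp.
rewrite diff_comp//= [in LHS]deriv1E; last exact/derivable1_diffP.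
rewrite derive1E (@derive_val _ _ _ _ _ _ _ (is_derive_flat _ _)).
exact: mulrC.
Qed.

(** The sum, product and chain rules are available only where the functions are differentiable, that
    is on [U]; [sg_eq] absorbs the discrepancy outside. *)
Lemma smooth_gen_partial U f i : open U -> smooth_gen U f ->
  smooth_gen U (partial i f).
Proof.
move=> oU; have sgd f' p := @smooth_gen_diff U f' p oU.
elim=> {f}.
- by move=> f sf; apply/sg_smooth/smooth_partial.
- by move=> f g _ df fg; apply: sg_eq df _; exact: eq_on_partial.
- move=> c; apply: (sg_eq (sg_cst U 0)) => p _.
  by rewrite partialE derive_cst.
- move=> f g sf df sg dg; apply: (sg_eq (sg_add df dg)) => p.
  rewrite inE => Up; rewrite [LHS]/= !fctE !partialE deriveD//;
    exact/diff_derivable/sgd.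
- move=> f g sf df sg dg.
  apply: (sg_eq (sg_add (sg_mul sf dg) (sg_mul sg df))) => p.
  rewrite inE => Up; rewrite [LHS]/= !fctE !partialE deriveM//;
    exact/diff_derivable/sgd.
- move=> n f sf df.
  apply: (sg_eq (sg_mul (sg_add (sg_flat n.+2 sf)
    (sg_mul (sg_cst U (- n%:R)) (sg_flat n.+1 sf))) df)) => p.
  rewrite inE => Up; rewrite [RHS]partialE derive_flat_comp//; last exact: sgd.
  by rewrite -partialE !fctE /= mulNr.
Qed.

Lemma smooth_gen_smooth U f : open U -> smooth_gen U f -> smooth_on U f.
Proof.
move=> oU; apply: (@smooth_ind U (smooth_gen U)) => {f}.
  by move=> f sf p; exact: smooth_gen_diff.
by move=> f i; exact: smooth_gen_partial.
Qed.

Lemma smooth_eq U f g : open U -> smooth_on U f -> {in U, f =1 g} ->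
  smooth_on U g.
Proof.
move=> oU sf fg; apply: smooth_gen_smooth => //.
by apply: sg_eq fg; exact: sg_smooth.
Qed.

End Smooth.

(** * Symmetry of mixed directional derivatives *)

Section Lines.
Context {R : realType} {V : normedModType R}.
Implicit Types (f : V -> R) (u v w p : V).

Lemma is_derive_line f u w (s df : R) :
  is_derive (s *: u + w) u f df ->
  is_derive s 1 (fun t => f (t *: u + w)) df.
Proof.
have e : (fun h : R => h^-1 *: (((fun t => f (t *: u + w)) \o shift s) (h *: (1 : R))
      - f (s *: u + w))) =
    (fun h : R => h^-1 *: ((f \o shift (s *: u + w)) (h *: u) - f (s *: u + w))).
  by apply/funext => h /=; rewrite [_ *: 1]mulr1 scalerDl addrA.
move=> [dv <-]; apply: DeriveDef; first by rewrite /derivable e.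
by rewrite /derive e.
Qed.

(** Symmetric in [u] and [v]; divided by [h ^+ 2] it approximates both mixed derivatives, which
    forces them to agree. *)
Definition second_diff f u v p (h : R) :=
  f (h *: u + (h *: v + p)) - f (h *: u + p) - (f (h *: v + p) - f p).

Lemma second_diffC f u v p h : second_diff f u v p h = second_diff f v u p h.
Proof.
rewrite /second_diff addrCA.
set a := f _; set b := f _; set c := f _; set d := f _; ring.
Qed.

(** By the mean value theorem along [u], the second difference is [h] times an
    increment of [D_u f] in the direction [v]. *)
Lemma second_diff_approx f u v p (e : R) : 0 < e ->
  (\near p, differentiable f p) -> differentiable (fun q => 'D_u f q) p ->
  \forall h \near 0^'+,
    `|second_diff f u v p h - h ^+ 2 * 'D_v (fun q => 'D_u f q) p| <= e * h ^+ 2.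
Proof.
move=> e0 df dG; set G := fun q => 'D_u f q.
(* Two first-order errors at rate [e / k] will be added, each at a point of norm at most
   [h (|u| + |v|)]; [k] makes their sum at most [e h]. The [+ 1] keeps [k] positive when
   [u = v = 0]. *)
set k := 2 * (`|u| + `|v|) + 1.
have k0 : 0 < k by rewrite ltr_wpDl// mulr_ge0// addr_ge0.
have /eqaddoP/(_ (e / k)) GE := diff_locally dG.
have {}GE := GE (divr_gt0 e0 k0).
have /nbhs_ballP[/=r r0 rP] : \forall z \near (0 : V),
    differentiable f (z + p) /\
    `|G (z + p) - G p - 'd G p z| <= e / k * `|z|.
  apply: filterI; first by have := df; rewrite (near_shift 0) subr0.
  apply: filterS GE => z; rewrite !fctE /= => zP.
  by rewrite -[X in `|X|]addrA -opprD.
have {}rP z : `|z| < r -> differentiable f (z + p) /\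
    `|G (z + p) - G p - 'd G p z| <= e / k * `|z|.
  by move=> zr; apply: rP => /=; rewrite -ball_normE /= sub0r normrN.
near=> h.
have h0 : 0 < h by near: h; exact: nbhs_right_gt.
have hr : h * k < r.
  by rewrite -ltr_pdivlMr//; near: h; apply: nbhs_right_lt; rewrite divr_gt0.
have normb (c : R) w : 0 <= c <= h -> `|w| <= h * `|v| ->
    `|c *: u + w| <= h * (`|u| + `|v|).
  move=> /andP[c0 ch] wh; apply: le_trans (ler_normD _ _) _.
  by rewrite mulrDr lerD// normrZ (ger0_norm c0) ler_wpM2r.
have small (c : R) w : 0 <= c <= h -> `|w| <= h * `|v| -> `|c *: u + w| < r.
  move=> ch wh; apply: le_lt_trans (normb _ _ ch wh) _.
  apply: le_lt_trans hr; rewrite ler_pM2l// /k.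
  by have := normr_ge0 u; have := normr_ge0 v; lra.
have hv : `|h *: v| <= h * `|v| by rewrite normrZ gtr0_norm.
have zv : `|0 : V| <= h * `|v| by rewrite normr0 mulr_ge0// ltW.
pose phi s := f (s *: u + (h *: v + p)) - f (s *: u + p).
pose dphi s := G (s *: u + (h *: v + p)) - G (s *: u + p).
have dphiP s : 0 <= s <= h -> is_derive s 1 phi (dphi s).
  move=> sh; apply: is_deriveB; apply: is_derive_line; apply: derivableP.
    by apply: diff_derivable; rewrite addrA; apply: (rP _ _).1; exact: small.
  by apply: diff_derivable; apply: (rP _ _).1; rewrite -[_ *: u]addr0 small.
have [c ch phiE] : exists2 c, c \in `]0, h[%R & phi h - phi 0 = dphi c * (h - 0).
  apply: MVT => //.
    move=> s; rewrite in_itv /= => /andP[s0 sh]; apply: dphiP.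
    by rewrite !ltW.
  apply: derivable_within_continuous => s; rewrite in_itv /= => /dphiP.
  by case.
have ch' : 0 <= c <= h by move: ch; rewrite in_itv /= => /andP[? ?]; rewrite !ltW.
have -> : second_diff f u v p h = dphi c * h.
  by rewrite -[in RHS](subr0 h) -phiE /phi scale0r !add0r.
have -> : 'D_v G p = 'd G p v by rewrite deriveE.
have [_ b1] := rP _ (small _ _ ch' hv).
have [_ b2] := rP _ (small _ _ ch' zv).
have n1 := normb _ _ ch' hv; have n2 := normb _ _ ch' zv.
have dhv : 'd G p (h *: v) = h *: 'd G p v by exact: linearZ.
rewrite linearD dhv in b1.
rewrite addr0 in b2 n2.
(* Between the two expansions of [G] at [p], the terms [G p] and ['d G p (c u)] cancel, so the
   unknown mean value point [c] disappears from the main term. *)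
have dE : dphi c * h - h ^+ 2 * 'd G p v = h *
   ((G (c *: u + h *: v + p) - G p - ('d G p (c *: u) + h *: 'd G p v))
   - (G (c *: u + p) - G p - 'd G p (c *: u))).
  by rewrite /dphi addrA /GRing.scale /=; ring.
rewrite dE normrM (gtr0_norm h0) expr2 mulrCA ler_pM2l//.
apply: le_trans (ler_normB _ _) _.
apply: le_trans (lerD b1 b2) _.
rewrite -mulrDr mulrAC ler_pdivrMr// -mulrA ler_pM2l//.
apply: le_trans (lerD n1 n2) _.
by rewrite -mulrDr [leRHS]mulrC [leLHS]mulrC ler_pM2r// /k mulr_natl mulr2n lerDl.
Unshelve. all: by end_near. Qed.

(** At one common small [h], each mixed derivative times [h ^+ 2] is within [e / 2 h ^+ 2] of the
    same second difference. This is Young's form: the first derivatives are only asked to be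
    differentiable at [p]. *)
Lemma schwarz f u v p :
  (\near p, differentiable f p) ->
  differentiable (fun q => 'D_u f q) p -> differentiable (fun q => 'D_v f q) p ->
  'D_u (fun q => 'D_v f q) p = 'D_v (fun q => 'D_u f q) p.
Proof.
move=> df du dv; apply/eqP; rewrite -subr_eq0 -normr_le0; apply/ler_addgt0Pr => e e0.
rewrite add0r.
have e20 : 0 < e / 2 by rewrite divr_gt0.
have A := second_diff_approx v e20 df du.
have B := second_diff_approx u e20 df dv.
have [h [h0 [a b]]] := filter_ex (@filterI _ _ _ _ _
  (nbhs_right_gt (0 : R)) (@filterI _ _ _ _ _ A B)).
rewrite (second_diffC f v u p h) in b.
have h20 : 0 < h ^+ 2 by rewrite exprn_gt0.
rewrite -(ler_pM2r h20) -[X in _ * X](ger0_norm (ltW h20)) -normrM.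
move: a b; set a := 'D_v _ _; set b := 'D_u _ _ => ha hb.
have -> : (b - a) * h ^+ 2 = (second_diff f u v p h - h ^+ 2 * a)
   - (second_diff f u v p h - h ^+ 2 * b) by ring.
apply: le_trans (ler_normB _ _) _; apply: le_trans (lerD ha hb) _.
by rewrite -mulrDl -splitr.
Qed.

End Lines.

(** * Integrals of partial derivatives *)

Section Measurability.
Context {R : realType}.
Local Notation E := ((R * R) * R)%type.

(** The measurable structure on R^3 is the product one. Balls of the product norm are boxes, hence
    measurable rectangles, and countably many of them with rational centres exhaust [U]. *)
Lemma open_measurable3 (U : set E) : open U -> measurable U.
Proof.
move=> oU.
pose box (i : rat * rat * rat * nat) : set E :=
  ball (((ratr i.1.1.1, ratr i.1.1.2), ratr i.1.2) : E) i.2.+1%:R^-1.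
pose F i := if `[< box i `<=` U >] then box i else set0.
have -> : U = \bigcup_i F i.
  apply/seteqP; split=> [p Up|p [i _]]; last first.
    by rewrite /F; case: asboolP => // bU; exact: bU.
  have /nbhs_ballP[/= r r0 rU] : nbhs p U by exact: open_nbhs_nbhs.
  (* The radius falls below [r / 2], so any box of that radius containing [p] lies within distance
     [r] of [p]. *)
  pose n := Num.truncn (2 / r).
  have nr : 2 * n.+1%:R^-1 < r.
    by rewrite ltr_pdivrMr// mulrC -ltr_pdivrMr// truncnS_gt.
  have approx (x : R) : exists q : rat, ball (ratr q : R) n.+1%:R^-1 x.
    have [q] := @rat_in_itvoo R (x - n.+1%:R^-1) (x + n.+1%:R^-1) ltac:(
      by rewrite ltrD2l gtrN// invr_gt0).
    rewrite in_itv /= => /andP[q1 q2]; exists q.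
    rewrite /ball /= ltr_norml; move: q1 q2; set e := _^-1 => q1 q2.
    by apply/andP; split; lra.
  have [[a ha] [b hb] [c hc]] := And3 (approx p.1.1) (approx p.1.2) (approx p.2).
  exists (a, b, c, n) => //; rewrite /F asboolT; first by split.
  move=> q bq; apply: rU; apply: le_ball (ltW nr) _ _.
  rewrite mulr_natl mulr2n; apply: ball_triangle bq.
  by apply: ball_sym; split.
apply: countable_bigcupT_measurable => // i; rewrite /F; case: ifP => // _.
have -> : box i = ball (ratr i.1.1.1 : R) i.2.+1%:R^-1
   `*` ball (ratr i.1.1.2 : R) i.2.+1%:R^-1 `*` ball (ratr i.1.2 : R) i.2.+1%:R^-1.
  by apply/seteqP; split.
by do 2 ?apply: measurableX => //; exact: measurable_ball.
Qed.

Lemma continuous_measurable3 (f : E -> R) : continuous f -> measurable_fun setT f.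
Proof.
move=> /continuousP cf; apply: (measurability _ (RGenOpens.measurableE R)).
move=> _ [_ [a [b ->] <-]]; rewrite setTI.
by apply: open_measurable3; exact/cf/interval_open.
Qed.

End Measurability.

Section IntegralDerive.
Context {R : realType}.
Local Notation E := ((R * R) * R)%type.
Local Notation mu := (@lebesgue_measure R).
Local Notation T := (measurableTypeR R).
Implicit Types (M K : R) (i : 'I_3).

Lemma integrable_bounded_supp d (T : measurableType d)
    (nu : {measure set T -> \bar R}) (f : T -> R) (A : set T) K :
  measurable A -> (nu A < +oo)%E -> measurable_fun setT f ->
  (forall x, `|f x| <= K) -> (forall x, ~ A x -> f x = 0) ->
  nu.-integrable setT (EFin \o f).
Proof.
move=> mA nuA mf fK fA.
have : nu.-integrable A (EFin \o f).
  apply: measurable_bounded_integrable => //; first exact: measurable_funTS.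
  by exists K; split; [exact: num_real|move=> x Kx y _; exact: le_trans (ltW Kx)].
move/(integrable_mkcond _ mA).1; congr (_.-integrable _ _).
apply/funext => x; rewrite patchE; case: ifPn => //.
by rewrite notin_setE => /fA /= ->.
Qed.

Lemma integral_derive_supp (F f : R -> R) M : 0 < M ->
  (forall x : R, is_derive x (1 : R) F (f x)) -> continuous f ->
  (forall x, M <= `|x| -> F x = 0) -> (\int[mu]_x (f x)%:E = 0)%E.
Proof.
move=> M0 dF cf FM.
(* The strict inequality leaves a neighbourhood of [x] on which [F] is zero. *)
have FE x : M < `|x| -> f x = 0.
  move=> Mx; rewrite -(@derive_val _ _ _ _ _ _ _ (dF x)).
  rewrite (near_eq_derive (g := cst 0)) ?derive_cst//.
  near=> y; apply: FM; apply/ltW; near: y.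
  have : (fun y : R => `|y|) @ x --> `|x| by exact: norm_continuous.
  by move=> /cvgr_gt; exact.
have cF : continuous F.
  by move=> x; apply/differentiable_continuous/derivable1_diffP; case: (dF x).
transitivity (\int[mu]_(x in `[(- M)%R, M]) (f x)%:E)%E.
  rewrite [RHS]integral_mkcond; apply: eq_integral => x _.
  rewrite patchE; case: ifPn => // /negP xM; rewrite FE// ltNge.
  apply/negP; rewrite ler_norml => /andP[? ?]; apply: xM.
  by rewrite inE /= in_itv /=; apply/andP.
rewrite (@continuous_FTC2 _ f F).
- by rewrite !FM ?normrN ?gtr0_norm// subee.
- by rewrite gtrN.
- exact: continuous_subspaceT.
- split; first by move=> x _; case: (dF x).
  + by apply: cvg_at_right_filter; exact: cF.
  + by apply: cvg_at_left_filter; exact: cF.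
- by move=> x _; rewrite derive1E; exact: derive_val.
Unshelve. all: by end_near. Qed.

Definition box1 M : set R := `[- M, M].

Lemma not_box1 M x : ~ box1 M x -> M < `|x|.
Proof.
rewrite /box1 /= in_itv /= => h; rewrite ltNge; apply/negP => xM; apply: h.
by rewrite -ler_norml.
Qed.

Lemma measurable_box1 M : measurable (box1 M).
Proof. exact: measurable_itv. Qed.

Lemma box1_fin M : (mu (box1 M) < +oo)%E.
Proof. by rewrite lebesgue_measure_itv /=; case: ifP; rewrite ?ltry. Qed.

Lemma box2_fin M : ((mu \x mu)%E (box1 M `*` box1 M) < +oo)%E.
Proof.
have mB := measurable_box1 M.
have -> : (mu \x mu)%E (box1 M `*` box1 M) = (mu (box1 M) * mu (box1 M))%E.
  exact: product_measure1E.
by rewrite lte_mul_pinfty// ?ge0_fin_numE// ?box1_fin.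
Qed.

Lemma box3_fin M : (leb3 (box1 M `*` box1 M `*` box1 M) < +oo)%E.
Proof.
have mB := measurable_box1 M.
have -> : leb3 (box1 M `*` box1 M `*` box1 M) =
    ((mu \x mu)%E (box1 M `*` box1 M) * mu (box1 M))%E.
  by apply: product_measure1E => //; exact: measurableX.
by rewrite lte_mul_pinfty// ?ge0_fin_numE// ?box1_fin ?box2_fin.
Qed.

Lemma leb2_sigma_finite : sigma_finite setT (mu \x mu)%E.
Proof.
have /sigma_finiteP[F [TF ndF Foo]] := @sigma_finiteT _ _ _ mu.
exists (fun n => F n `*` F n).
  rewrite -setXTT TF predeqE => -[x y]; split.
    move=> [/= [n _ Fnx] [k _ Gky]]; exists (maxn n k) => //; split.
    - by move: x Fnx; exact/subsetPset/ndF/leq_maxl.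
    - by move: y Gky; exact/subsetPset/ndF/leq_maxr.
  by move=> [n _ []/= ? ?]; split; exists n.
move=> k; have [? ?] := Foo k.
split; first exact: measurableX.
have -> : (mu \x mu)%E (F k `*` F k) = (mu (F k) * mu (F k))%E.
  exact: product_measure1E.
by rewrite lte_mul_pinfty// ge0_fin_numE.
Qed.

(** The library's canonical sigma-finite structure on a product of measures
    covers only subprobabilities. *)
Definition leb2 : {sigma_finite_measure set (T * T)%type -> \bar R} :=
  HB.pack_for {sigma_finite_measure set (T * T)%type -> \bar R} (mu \x mu)%E
    (Measure_isSigmaFinite.Build _ _ _ (mu \x mu)%E leb2_sigma_finite).

Section Box.
Variables (g : E -> R) (M K : R).
Hypothesis cg : continuous g.
Hypothesis gK : forall p, `|g p| <= K.
Hypothesis gM : forall p, M <= `|p| -> g p = 0.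

Lemma box_integrable3 : leb3.-integrable setT (EFin \o g).
Proof.
rewrite /leb3.
apply: (@integrable_bounded_supp _ _ ((mu \x mu) \x mu)%E g
  (box1 M `*` box1 M `*` box1 M) K) => //.
- by do 2 ?apply: measurableX => //; exact: measurable_box1.
- exact: box3_fin.
- exact: continuous_measurable3.
- move=> [[x y] z] h; apply: gM; apply/ltW; rewrite !prod_normE /= !lt_max.
  apply: contrapT => /negP; rewrite !negb_or => /andP[/andP[hx hy] hz].
  by apply: h; split; [split|] => /=; apply: contrapT => /not_box1;
    [exact/negP|exact/negP|exact/negP].
Qed.

Lemma box_integrable2 z :
  (mu \x mu)%E.-integrable setT (fun q => (g (q, z))%:E).
Proof.
apply: (@integrable_bounded_supp _ _ (mu \x mu)%E (fun q => g (q, z))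
  (box1 M `*` box1 M) K) => //.
- by apply: measurableX; exact: measurable_box1.
- exact: box2_fin.
- by apply: (measurableT_comp (f := g)) => //; exact: continuous_measurable3.
- move=> [x y] h; apply: gM; apply/ltW; rewrite !prod_normE /= !lt_max.
  apply: contrapT => /negP; rewrite !negb_or => /andP[/andP[hx hy] hz].
  by apply: h; split => /=; apply: contrapT => /not_box1; exact/negP.
Qed.
End Box.

Lemma lineE (t a b c x y z : R) :
  t *: (((a, b), c) : E) + ((x, y), z) = ((t * a + x, t * b + y), t * c + z).
Proof. by []. Qed.

Section PartialBox.
Variables (W : E -> R) (i : 'I_3) (M K : R).
Hypothesis M0 : 0 < M.
Hypothesis dW : forall p, derivable W p (basis i).
Hypothesis cW : continuous (partial i W).
Hypothesis WK : forall p, `|partial i W p| <= K.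
Hypothesis WM : forall p, M <= `|p| -> W p = 0 /\ partial i W p = 0.

(** The bound of [|t|] by the norm of [s t] says that the line leaves the box: for [|t|] at least
    [M] the function vanishes along it, so the one-dimensional result applies. *)
Lemma integral_partial_line (s : R -> E) (v : E) :
  (forall t, s t = t *: v + s 0) -> v = basis i ->
  (forall t, `|t| <= `|s t|) ->
  (\int[mu]_t (partial i W (s t))%:E = 0)%E.
Proof.
move=> sE vE sM; subst v.
apply: (@integral_derive_supp (W \o s) (partial i W \o s) M M0).
- move=> t.
  have d : is_derive (t *: basis i + s 0) (basis i) W (partial i W (s t)).
    by rewrite -sE partialE; exact: derivableP.
  have -> : W \o s = fun r => W (r *: basis i + s 0).
    by apply/funext => r /=; rewrite -sE.
  exact: is_derive_line d.
- move=> t; apply: continuous_comp; last exact: cW.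
  have -> : s = (fun t => t *: basis i + s 0) by apply/funext.
  by apply: cvgD; [exact: scalel_continuous | exact: cvg_cst].
- by move=> t Mt; apply: (WM _).1; exact: le_trans (sM t).
Qed.

Lemma integral_partial_box : (\int[leb3]_p (partial i W p)%:E = 0)%E.
Proof.
have i3 : (leb2 \x mu)%E.-integrable setT (EFin \o partial i W).
  by apply: (@box_integrable3 _ M K) => // p /WM[].
have i2 z : (mu \x mu)%E.-integrable setT (fun q => (partial i W (q, z))%:E).
  by apply: (@box_integrable2 _ M K) => // p /WM[].
have : (i == 0%N :> nat) || (i == 1%N :> nat) || (i == 2%N :> nat).
  by case: i => [[|[|[|]]]].
(* In each case the order of integration puts the variable of differentiation innermost, so already
   the inner integral is zero. *)
move=> /orP[/orP[|]|] /eqP i_eq.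
- apply: (etrans (esym (@integral21_prod_meas1 _ _ _ _ R leb2 mu _ i3))).
  apply: integral0_eq => z _.
  apply: (etrans (esym (@integral21_prod_meas1 _ _ _ _ R mu mu _ (i2 z)))).
  apply: integral0_eq => y _.
  apply: (@integral_partial_line (fun x => ((x, y), z)) e_x).
  + by move=> t; rewrite lineE !mulr1 !mulr0 !addr0 !add0r.
  + by rewrite /basis i_eq.
  + by move=> t; rewrite !prod_normE /= !le_max lexx.
- apply: (etrans (esym (@integral21_prod_meas1 _ _ _ _ R leb2 mu _ i3))).
  apply: integral0_eq => z _.
  apply: (etrans (esym (@integral12_prod_meas1 _ _ _ _ R mu mu _ (i2 z)))).
  apply: integral0_eq => x _.
  apply: (@integral_partial_line (fun y => ((x, y), z)) e_y).
  + by move=> t; rewrite lineE !mulr1 !mulr0 !addr0 !add0r.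
  + by rewrite /basis i_eq.
  + by move=> t; rewrite !prod_normE /= !le_max lexx orbT.
- apply: (etrans (esym (@integral12_prod_meas1 _ _ _ _ R leb2 mu _ i3))).
  apply: integral0_eq => -[x y] _.
  apply: (@integral_partial_line (fun z => ((x, y), z)) e_z).
  + by move=> t; rewrite lineE !mulr1 !mulr0 !addr0 !add0r.
  + by rewrite /basis i_eq.
  + by move=> t; rewrite !prod_normE /= !le_max lexx orbT.
Qed.

End PartialBox.
End IntegralDerive.

(** * Extension by zero of functions with compact support in the chart *)

Section CompactSupport.
Context {R : realType}.
Local Notation E := ((R * R) * R)%type.
Implicit Types (U C : set E) (f g : E -> R) (i : 'I_3).

Lemma compact_supp_bound f C : continuous f -> compact C ->
  (forall p, ~ C p -> f p = 0) ->
  exists M K : R, [/\ 0 < M, forall p, `|f p| <= K &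
    forall p, M <= `|p| -> ~ C p].
Proof.
move=> cf cC fC.
have [M M0 CM] : exists2 M : R, 0 < M & forall p, C p -> `|p| < M.
  have /ex_strict_bound_gt0[M M0 CM] := compact_bounded cC.
  by exists M => // p /CM.
have [K K0 fK] : exists2 K : R, 0 < K & forall p, C p -> `|f p| < K.
  have /compact_bounded/ex_strict_bound_gt0[K K0 fK] :
      compact (f @` C).
    by apply: continuous_compact => //; exact: continuous_subspaceT.
  by exists K => // p Cp; apply: fK; exists p.
exists M, K; split => // p.
  have [/fK/ltW//|/fC ->] := pselect (C p); by rewrite normr0 ltW.
by move=> Mp /CM; rewrite ltNge Mp.
Qed.

Section Patch.
Variables (U C : set E) (f : E -> R).
Hypotheses (oU : open U) (cC : compact C) (CU : C `<=` U).
Hypotheses (sf : smooth_on U f) (fC : forall p, U p -> ~ C p -> f p = 0).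

Lemma patch_supp p : ~ C p -> (f \_ U) p = 0.
Proof.
by rewrite patchE; case: ifPn => // /set_mem Up Cp; exact: fC.
Qed.

Lemma compact_openC : open (~` C).
Proof.
by rewrite openC; apply: compact_closed => //; exact: norm_hausdorff.
Qed.

(** The open sets [U] and the complement of [C] cover R^3; the extension is [f] on the first and 0
    on the second, and smoothness is local. *)
Lemma patch_smooth : smooth_on setT (f \_ U).
Proof.
have sU : smooth_on U (f \_ U).
  by apply: smooth_eq sf _ => // p pU; rewrite patchE pU.
have sC : smooth_on (~` C) (f \_ U).
  apply: (@smooth_gen_smooth _ (~` C)); first exact: compact_openC.
  apply: (sg_eq (sg_cst _ 0)) => p; rewrite inE => Cp.
  by rewrite patch_supp.
move=> s p _; have [Cp|Cp] := pselect (C p); last exact: sC.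
by apply: sU; exact: CU.
Qed.

Lemma patch_partial_supp i p : ~ C p -> partial i (f \_ U) p = 0.
Proof.
move=> Cp; rewrite partialE (near_eq_derive (g := cst 0)) ?derive_cst//.
have := near_open compact_openC Cp (f := f \_ U) (g := cst 0); apply.
by move=> q; rewrite inE => Cq; exact: patch_supp.
Qed.

Lemma smooth_continuous g : smooth_on setT g -> continuous g.
Proof. by move=> sg p; apply/differentiable_continuous; exact: smooth_diff sg _. Qed.

Lemma supp_integrable : leb3.-integrable U (EFin \o f).
Proof.
have mU := open_measurable3 oU.
have cF := smooth_continuous patch_smooth.
have [M [K [M0 FK FM]]] := compact_supp_bound cF cC patch_supp.
have := @integrable_mkcond _ _ _ ((@lebesgue_measure R \x
  @lebesgue_measure R) \x @lebesgue_measure R)%E _ (EFin \o f) mU.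
move=> [_]; apply.
have -> : (EFin \o f) \_ U = EFin \o (f \_ U).
  by apply/funext => p; rewrite !patchE /= patchE; case: ifP.
by apply: box_integrable3 cF FK _ => p /FM; exact: patch_supp.
Qed.

Lemma integral_partial_supp i :
  \int[leb3]_(p in U) partial i f p = 0.
Proof.
have sF := smooth_partial i patch_smooth.
have cF := smooth_continuous sF.
have [M [K [M0 FK FM]]] := compact_supp_bound cF cC (@patch_partial_supp i).
rewrite Rintegral_mkcond /Rintegral.
have -> : (fun p => ((partial i f \_ U) p)%:E) =
    (fun p => (partial i (f \_ U) p)%:E).
  apply/funext => p; congr EFin; rewrite patchE; case: ifPn => [pU|pU].
    apply: (@eq_on_partial _ U f (f \_ U) i oU _ p pU) => q qU.
    by rewrite patchE qU.
  rewrite notin_setE in pU; rewrite patch_partial_supp// => /CU; exact: pU.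
rewrite (@integral_partial_box _ (f \_ U) i M K)//.
- by move=> p; apply/diff_derivable; exact: smooth_diff patch_smooth _.
- by move=> p /FM Cp; rewrite patch_supp// patch_partial_supp.
Qed.
End Patch.
End CompactSupport.

(** * Contact vector fields *)

Section Coordinates.
Context {R : realType}.
Local Notation E := ((R * R) * R)%type.
Implicit Types (U : set E) (f g : E -> R) (p u v w : E).

Lemma is_diff_fst (V W : normedModType R) (p : V * W) : is_diff p fst fst.
Proof.
apply: DiffDef; first by apply: linear_differentiable => x; exact: cvg_fst.
by apply: diff_lin => x; exact: cvg_fst.
Qed.

Lemma is_diff_snd (V W : normedModType R) (p : V * W) : is_diff p snd snd.
Proof.
apply: DiffDef; first by apply: linear_differentiable => x; exact: cvg_snd.
by apply: diff_lin => x; exact: cvg_snd.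
Qed.

Lemma is_diff_cx p : is_diff p (@cx R) (@cx R).
Proof. exact: (is_diff_comp (is_diff_fst p) (is_diff_fst p.1)). Qed.

Lemma is_diff_cy p : is_diff p (@cy R) (@cy R).
Proof. exact: (is_diff_comp (is_diff_fst p) (is_diff_snd p.1)). Qed.

Lemma is_diff_cz p : is_diff p (@cz R) (@cz R).
Proof. exact: is_diff_snd. Qed.

Lemma derive_cx p v : 'D_v (@cx R) p = cx v.
Proof. have d := is_diff_cx p; by rewrite deriveE// diff_val. Qed.

Lemma smooth_coord U (c : E -> R) : (forall p, is_diff p c c) -> smooth_on U c.
Proof.
move=> dc; apply: (@smooth_ind _ U (fun f => f = c \/ exists a, f = cst a)).
- move=> f [->|[a ->]] p _; last exact: differentiable_cst.
  by have [] := dc p.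
- move=> f i [->|[a ->]]; right.
    exists (c (basis i)); apply/funext => p.
    by rewrite partialE; have d := dc p; rewrite deriveE// diff_val.
  by exists 0; apply/funext => p; rewrite partialE derive_cst.
- by left.
Qed.

Definition det3 u v w : R :=
  cx u * (cy v * cz w - cz v * cy w) - cy u * (cx v * cz w - cz v * cx w)
  + cz u * (cx v * cy w - cy v * cx w).

Lemma dform1_sigma p u v : dform1 sigma p u v = cx u * cy v - cx v * cy u.
Proof.
have dS a b : 'D_a ((@sigma R) ^~ b) p = cx a * cy b.
  have dc : derivable (@cx R) p a by apply: diff_derivable; have [] := is_diff_cx p.
  have -> : sigma ^~ b = (cx : E -> R) * cst (cy b) + cst (cz b) by [].
  rewrite deriveD//; last exact: derivableM.
  rewrite deriveM// !derive_cst derive_cx addr0 scaler0 add0r.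
  exact: mulrC.
by rewrite /dform1 !dS.
Qed.

(** The exterior derivative of [sigma] is dx /\ dy, which kills the [x dy] part of [sigma]: [dmu] is
    the constant form dx /\ dy /\ dz, and [int_dmu] is plain Lebesgue integration. *)
Lemma dmuE p u v w : dmu p u v w = det3 u v w.
Proof. rewrite /dmu /wedge21 !dform1_sigma /sigma /det3; ring. Qed.

Lemma det3_basis : det3 e_x e_y e_z = 1.
Proof. rewrite /det3 /cx /cy /cz /=; ring. Qed.

Lemma int_dmuE U f : int_dmu U f = \int[leb3]_(p in U) f p.
Proof.
rewrite /int_dmu; congr (Rintegral _ _ _); apply/funext => p.
by rewrite dmuE det3_basis mulr1.
Qed.

End Coordinates.

Section Contact.
Context {R : realType}.
Local Notation E := ((R * R) * R)%type.
Variable U : set E.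
Hypothesis oU : open U.
Implicit Types (f g H K L : E -> R) (p u v w : E).

Lemma smooth_cst (a : R) : smooth_on U (fun=> a).
Proof. by apply: smooth_gen_smooth => //; exact: sg_cst. Qed.

Lemma smoothD f g : smooth_on U f -> smooth_on U g ->
  smooth_on U (fun p => f p + g p).
Proof.
by move=> sf sg; apply: smooth_gen_smooth => //; apply: sg_add; exact: sg_smooth.
Qed.

Lemma smoothM f g : smooth_on U f -> smooth_on U g ->
  smooth_on U (fun p => f p * g p).
Proof.
by move=> sf sg; apply: smooth_gen_smooth => //; apply: sg_mul; exact: sg_smooth.
Qed.

Lemma smoothN f : smooth_on U f -> smooth_on U (fun p => - f p).
Proof.
move=> sf; apply: (smooth_eq oU (smoothM (smooth_cst (-1)) sf)) => p _.
by rewrite mulN1r.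
Qed.

Lemma smooth_dx f : smooth_on U f -> smooth_on U (dx f).
Proof. exact: (@smooth_partial _ _ 0). Qed.

Lemma smooth_dy f : smooth_on U f -> smooth_on U (dy f).
Proof. exact: (@smooth_partial _ _ 1). Qed.

Lemma smooth_dz f : smooth_on U f -> smooth_on U (dz f).
Proof. exact: (@smooth_partial _ _ ord_max). Qed.

Lemma smooth_cx : smooth_on U cx.
Proof. exact/smooth_coord/is_diff_cx. Qed.

Definition contact_x K p := dy K p - cx p * dz K p.
Definition contact_y K p := - dx K p.
Definition contact_z K p := - K p + cx p * dx K p.

Ltac smooth := repeat match goal with
  | H : ?P |- ?P => exact H
  | |- smooth_on _ (fun p => @?f p + @?g p) => apply: (@smoothD f g)
  | |- smooth_on _ (fun p => @?f p * @?g p) => apply: (@smoothM f g)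
  | |- smooth_on _ (fun p => - @?f p) => apply: (@smoothN f)
  | |- smooth_on _ (fun p => cx p) => exact: smooth_cx
  | |- smooth_on _ (fun p => dx ?f p) => apply: (@smooth_dx f)
  | |- smooth_on _ (fun p => dy ?f p) => apply: (@smooth_dy f)
  | |- smooth_on _ (fun p => dz ?f p) => apply: (@smooth_dz f)
  | |- smooth_on _ (fun p => ?f p) => change (smooth_on U f)
  | |- smooth_on _ (fun p => ?a) => exact: (@smooth_cst a)
  end.

Lemma smooth_contact_x K : smooth_on U K -> smooth_on U (contact_x K).
Proof. by move=> sK; rewrite /contact_x; smooth. Qed.

Lemma smooth_contact_y K : smooth_on U K -> smooth_on U (contact_y K).
Proof. by move=> sK; rewrite /contact_y; smooth. Qed.

Lemma smooth_contact_z K : smooth_on U K -> smooth_on U (contact_z K).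
Proof. by move=> sK; rewrite /contact_z; smooth. Qed.

Lemma smooth_bracket L K : smooth_on U L -> smooth_on U K ->
  smooth_on U (bracket_c L K).
Proof. by move=> sL sK; rewrite /bracket_c; smooth. Qed.

Lemma derive_partials f p v : differentiable f p ->
  'D_v f p = cx v * dx f p + cy v * dy f p + cz v * dz f p.
Proof.
move=> df; rewrite /dx /dy /dz !deriveE//.
have {1}-> : v = cx v *: e_x + (cy v *: e_y + cz v *: e_z).
  transitivity (cx v *: e_x + (cy v *: e_y + (cz v *: e_z + ((0, 0), 0)))).
    case: v => [[a b] c]; rewrite /e_x /e_y /e_z !lineE /cx /cy /cz /=.
    by congr ((_, _), _); rewrite /GRing.scale /=; ring.
  by congr (_ + (_ + _)); exact: addr0.
by rewrite addrA !linearD !linearZ.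
Qed.

Lemma J_LPE L K p : differentiable K p ->
  J_LP L K p = contact_x L p * dx K p + contact_y L p * dy K p
    + contact_z L p * dz K p + 4 * L p * dz K p + dz L p * K p.
Proof. by move=> dK; rewrite /J_LP /vfapp derive_partials. Qed.

Lemma smooth_J_LP L K : smooth_on U L -> smooth_on U K -> smooth_on U (J_LP L K).
Proof.
move=> sL sK; pose sx := smooth_contact_x sL; pose sy := smooth_contact_y sL.
pose sz := smooth_contact_z sL.
apply: (@smooth_eq _ _ (fun p => contact_x L p * dx K p + contact_y L p * dy K p
    + contact_z L p * dz K p + 4 * L p * dz K p + dz L p * K p)) => //.
  by smooth.
by move=> p; rewrite inE => Up; rewrite J_LPE//; exact: smooth_diff sK Up.
Qed.

Lemma derive_mulf f g p v : differentiable f p -> differentiable g p ->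
  'D_v (fun q => f q * g q) p = 'D_v f p * g p + f p * 'D_v g p.
Proof.
move=> df dg; rewrite (deriveM (f := f) (g := g)); try exact: diff_derivable.
by rewrite addrC /GRing.scale /= [X in X + _]mulrC.
Qed.

Lemma derive_addf f g p v : differentiable f p -> differentiable g p ->
  'D_v (fun q => f q + g q) p = 'D_v f p + 'D_v g p.
Proof.
by move=> df dg; rewrite (deriveD (f := f) (g := g))//; exact: diff_derivable.
Qed.

Lemma derive_oppf f p v : differentiable f p ->
  'D_v (fun q => - f q) p = - 'D_v f p.
Proof. by move=> df; rewrite (deriveN (f := f))//; exact: diff_derivable. Qed.

Lemma partial_comm K u v p : smooth_on U K -> U p ->
  smooth_on U (fun q => 'D_u K q) -> smooth_on U (fun q => 'D_v K q) ->
  'D_u (fun q => 'D_v K q) p = 'D_v (fun q => 'D_u K q) p.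
Proof.
move=> sK Up su sv; apply: schwarz.
- have : \forall q \near p, U q by exact: open_nbhs_nbhs.
  by apply: filterS => q; exact: smooth_diff sK.
- exact: smooth_diff su Up.
- exact: smooth_diff sv Up.
Qed.

(** One [- dz K] comes from the coefficient [cx] differentiated in the first component, the other
    from [- K] in the third; the second derivatives cancel in pairs by symmetry. *)
Lemma contact_div K p : smooth_on U K -> U p ->
  dx (contact_x K) p + dy (contact_y K) p + dz (contact_z K) p = - 2 * dz K p.
Proof.
move=> sK Up.
have sd f : smooth_on U f -> differentiable f p.
  by move=> sf; exact: smooth_diff sf Up.
have [dX dY dZ dC dK] := And5 (sd _ (smooth_dx sK)) (sd _ (smooth_dy sK))
  (sd _ (smooth_dz sK)) (sd _ smooth_cx) (sd _ sK).
have dcZ : differentiable (fun q => cx q * dz K q) p.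
  exact: (differentiableM dC dZ).
have dcX : differentiable (fun q => cx q * dx K q) p.
  exact: (differentiableM dC dX).
have -> : dx (contact_x K) p = dx (dy K) p - (dz K p + cx p * dx (dz K) p).
  rewrite {1}/dx /contact_x derive_addf//; last exact: (differentiableN dcZ).
  rewrite derive_oppf//.
  by rewrite derive_mulf// derive_cx mul1r.
have -> : dy (contact_y K) p = - dy (dx K) p by rewrite {1}/dy derive_oppf.
have -> : dz (contact_z K) p = - dz K p + cx p * dz (dx K) p.
  rewrite {1}/dz /contact_z derive_addf//; last exact: (differentiableN dK).
  by rewrite derive_oppf// derive_mulf// derive_cx mul0r add0r.
have -> : dx (dy K) p = dy (dx K) p.
  by apply: partial_comm => //; [exact: smooth_dx|exact: smooth_dy].
have -> : dx (dz K) p = dz (dx K) p.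
  by apply: partial_comm => //; [exact: smooth_dx|exact: smooth_dz].
ring.
Qed.

Lemma div_contact_vf K p : smooth_on U K -> U p ->
  div_dmu (contact_vf K) p = - 2 * dz K p.
Proof.
move=> sK Up.
have dx_ := smooth_diff (smooth_contact_x sK) Up.
have dy_ := smooth_diff (smooth_contact_y sK) Up.
have dz_ := smooth_diff (smooth_contact_z sK) Up.
have dX v : 'D_v (contact_vf K) p =
    ((('D_v (contact_x K) p), 'D_v (contact_y K) p), 'D_v (contact_z K) p).
  have -> : contact_vf K =
    fun q => ((contact_x K q, contact_y K q), contact_z K q) by [].
  have dxy : differentiable (fun q => (contact_x K q, contact_y K q)) p.
    exact: differentiable_pair.
  rewrite !deriveE//; last exact: differentiable_pair.
  by rewrite diff_pair//= diff_pair.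
(* As [dmu] has constant coefficients, only the terms differentiating the field remain; inserting a
   matrix in each slot of a determinant in turn gives its trace times the determinant. *)
have LE u v w : Lie3 (contact_vf K) dmu p u v w = - 2 * dz K p * dmu p u v w.
  rewrite -contact_div// /Lie3.
  have -> : (fun q => dmu q u v w) = cst (det3 u v w).
    by apply/funext => q; exact: dmuE.
  rewrite derive_cst add0r !dmuE !dX.
  rewrite !(derive_partials _ dx_) !(derive_partials _ dy_) !(derive_partials _ dz_).
  rewrite /det3 /cx /cy /cz /=; ring.
have [c0 c0P] : exists c, forall u v w,
    Lie3 (contact_vf K) dmu p u v w = c * dmu p u v w by exists (- 2 * dz K p).
have := @getPex _ [set c : R | forall u v w,
    Lie3 (contact_vf K) dmu p u v w = c * dmu p u v w] (ex_intro _ _ c0P).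
(* The chosen number satisfies the identity for all vectors; the basis, where [dmu] is 1, pins it
   down. *)
move=> /(_ e_x e_y e_z); rewrite LE -/(div_dmu _ _) dmuE.
by rewrite det3_basis !mulr1 => <-.
Qed.

End Contact.

(** * Integration by parts along a contact vector field *)

Section ByParts.
Context {R : realType}.
Local Notation E := ((R * R) * R)%type.
Variables (U : set E).
Hypothesis oU : open U.
Implicit Types (C : set E) (f g H K L : E -> R) (p : E).

(** Off its relative support [f] vanishes on a whole neighbourhood, hence so do its derivatives; a
    mere zero of [f] would not control first order expressions. *)
Lemma supp_in_vanish f p : U p -> ~ supp_in U f p ->
  f p = 0 /\ forall i, partial i f p = 0.
Proof.
move=> Up /not_andP[//|fp].
have near0 : \near p, f p = cst 0 p.
  have oV : open (U `&` ~` closure (U `&` [set p | f p != 0])).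
    by apply: openI => //; rewrite openC; exact: closed_closure.
  apply: near_open oV _ _; first by split.
  move=> q; rewrite inE => -[Uq fq]; apply/eqP/negP => /negP fq0.
  by apply: fq; apply: subset_closure.
split; first exact: (nbhs_singleton near0).
by move=> i; rewrite partialE (near_eq_derive _ near0) derive_cst.
Qed.

Section OnCompact.
Variable C : set E.
Hypotheses (cC : compact C) (CU : C `<=` U).

Definition vanish_off f := forall p, U p -> ~ C p -> f p = 0.

Lemma eq_int_div f g (V1 V2 V3 : E -> R) :
  smooth_on U f -> smooth_on U g -> vanish_off f -> vanish_off g ->
  smooth_on U V1 -> smooth_on U V2 -> smooth_on U V3 ->
  vanish_off V1 -> vanish_off V2 -> vanish_off V3 ->
  (forall p, U p -> f p - g p = dx V1 p + dy V2 p + dz V3 p) ->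
  int_dmu U f = int_dmu U g.
Proof.
move=> sf sg f0 g0 s1 s2 s3 v1 v2 v3 fg.
have mU := open_measurable3 oU.
have pU i V : smooth_on U V -> vanish_off V ->
    leb3.-integrable U (EFin \o partial i V).
  move=> sV V0; apply: (@supp_integrable _ U C) => //.
    exact: smooth_partial.
  move=> p Up Cp; rewrite partialE (near_eq_derive (g := cst 0)) ?derive_cst//.
  have oV : open (U `&` ~` C) by apply: openI => //; exact: compact_openC.
  apply: near_open oV _ _ => // q; rewrite inE => -[]; exact: V0.
have i1 := pU 0 _ s1 v1; have i2 := pU 1 _ s2 v2; have i3 := pU ord_max _ s3 v3.
have if_ : leb3.-integrable U (EFin \o f) by exact: (@supp_integrable _ U C).
have ig : leb3.-integrable U (EFin \o g) by exact: (@supp_integrable _ U C).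
rewrite !int_dmuE; apply/eqP; rewrite -subr_eq0 -RintegralB//; apply/eqP.
transitivity (\int[leb3]_(p in U) ((partial 0 V1 p + partial 1 V2 p)
  + partial ord_max V3 p)).
  by apply: eq_Rintegral => p; rewrite inE => Up; rewrite fg.
have i12 : leb3.-integrable U (EFin \o (fun p => partial 0 V1 p + partial 1 V2 p)).
  by have := @integrableD _ _ _ ((@lebesgue_measure R \x @lebesgue_measure R)
    \x @lebesgue_measure R)%E U mU _ _ i1 i2.
rewrite RintegralD//.
rewrite RintegralD//.
by rewrite !(@integral_partial_supp _ U C)// !addr0.
Qed.

(** Each term of the two integrands and of the field [L H X_K] has a factor from each of [H], [K],
    [L], possibly differentiated, so it vanishes off [C] once one of the three vanishes nearby. The
    disjunction covers both a compact common support and a compactly supported [H] alone. *)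
Lemma by_parts H K L :
  smooth_on U H -> smooth_on U K -> smooth_on U L ->
  (forall p, U p -> ~ C p ->
    [\/ ~ supp_in U H p, ~ supp_in U K p | ~ supp_in U L p]) ->
  int_dmu U (fun p => L p * bracket_c H K p) =
  int_dmu U (fun p => H p * J_LP L K p).
Proof.
move=> sH sK sL sC.
have sa := smooth_contact_x oU sK; have sb := smooth_contact_y oU sK.
have sc := smooth_contact_z oU sK.
have vanish p : U p -> ~ C p ->
    [\/ H p = 0 /\ forall i, partial i H p = 0,
        K p = 0 /\ forall i, partial i K p = 0 |
        L p = 0 /\ forall i, partial i L p = 0].
  move=> Up /(sC _ Up)[] /(supp_in_vanish Up);
    by [constructor 1|constructor 2|constructor 3].
have vLH f : (forall p, K p = 0 -> (forall i, partial i K p = 0) -> f p = 0) ->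
    vanish_off (fun p => L p * H p * f p).
  move=> Kf p Up /(vanish _ Up)[[->]|[k0 k1]|[->]] => [_||_].
  - by rewrite mulr0 mul0r.
  - by rewrite (Kf p) ?mulr0.
  - by rewrite !mul0r.
have kx p : (forall i, partial i K p = 0) -> dx K p = 0 by move/(_ 0).
have ky p : (forall i, partial i K p = 0) -> dy K p = 0 by move/(_ 1).
have kz p : (forall i, partial i K p = 0) -> dz K p = 0 by move/(_ ord_max).
apply: (@eq_int_div _ _ (fun p => L p * H p * contact_x K p)
  (fun p => L p * H p * contact_y K p) (fun p => L p * H p * contact_z K p)).
- by apply: smoothM => //; exact: smooth_bracket.
- by apply: smoothM => //; exact: smooth_J_LP.
- move=> p Up /(vanish _ Up)[[h0 h1]|[k0 k1]|[-> _]]; last by rewrite mul0r.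
  + rewrite /bracket_c h0 (h1 0 : dx H p = 0) (h1 1 : dy H p = 0).
    rewrite (h1 ord_max : dz H p = 0); ring.
  + by rewrite /bracket_c k0 kx// ky// kz//; ring.
- move=> p Up /(vanish _ Up)[[-> _]|[k0 k1]|[l0 l1]]; first by rewrite mul0r.
  + rewrite J_LPE ?k0 ?kx ?ky ?kz//; last exact: smooth_diff sK Up.
    ring.
  + rewrite J_LPE; last exact: smooth_diff sK Up.
    rewrite /contact_x /contact_y /contact_z l0 (l1 0 : dx L p = 0).
    rewrite (l1 1 : dy L p = 0) (l1 ord_max : dz L p = 0); ring.
- by do 2 apply: smoothM => //.
- by do 2 apply: smoothM => //.
- by do 2 apply: smoothM => //.
- by apply: vLH => p k0 k1; rewrite /contact_x ky// kz// mulr0 subr0.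
- by apply: vLH => p k0 k1; rewrite /contact_y kx// oppr0.
- by apply: vLH => p k0 k1; rewrite /contact_z k0 kx// mulr0 oppr0 addr0.
- move=> p Up.
  have [dH dK dL] :=
    And3 (smooth_diff sH Up) (smooth_diff sK Up) (smooth_diff sL Up).
  have [da db dc] :=
    And3 (smooth_diff sa Up) (smooth_diff sb Up) (smooth_diff sc Up).
  have dprod v f : differentiable f p -> 'D_v (fun q => L q * H q * f q) p =
      ('D_v L p * H p + L p * 'D_v H p) * f p + L p * H p * 'D_v f p.
    move=> df; have dLH := differentiableM dL dH.
    by rewrite (derive_mulf v dLH df) (derive_mulf v dL dH).
  have -> : dx (fun p => L p * H p * contact_x K p) p
    + dy (fun p => L p * H p * contact_y K p) p
    + dz (fun p => L p * H p * contact_z K p) p =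
    (dx L p * H p + L p * dx H p) * contact_x K p
    + (dy L p * H p + L p * dy H p) * contact_y K p
    + (dz L p * H p + L p * dz H p) * contact_z K p
    + L p * H p * (dx (contact_x K) p + dy (contact_y K) p + dz (contact_z K) p).
    have Ex := dprod e_x _ da; have Ey := dprod e_y _ db; have Ez := dprod e_z _ dc.
    apply: (etrans (congr2 +%R (congr2 +%R Ex Ey) Ez)).
    rewrite -/(dx L p) -/(dx H p) -/(dy L p) -/(dy H p) -/(dz L p) -/(dz H p).
    rewrite -/(dx (contact_x K) p) -/(dy (contact_y K) p) -/(dz (contact_z K) p).
    ring.
  rewrite (contact_div oU)// J_LPE// /bracket_c /contact_x /contact_y /contact_z.
  ring.
Qed.

End OnCompact.
End ByParts.

(** * The fundamental lemma of the calculus of variations *)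

Section Fundamental.
Context {R : realType}.
Local Notation E := ((R * R) * R)%type.
Local Notation mu := (@lebesgue_measure R).
Implicit Types (U C : set E) (f g A B : E -> R) (p : E).

Lemma ball3_measure_gt0 (p : E) (e : R) : 0 < e -> (0 < leb3 (ball p e))%E.
Proof.
move=> e0.
have mB (x : R) : measurable (ball x e) by exact: measurable_ball.
have -> : leb3 (ball p e) =
    (mu (ball p.1.1 e) * mu (ball p.1.2 e) * mu (ball p.2 e))%E.
  have -> : ball p e = ball p.1.1 e `*` ball p.1.2 e `*` ball p.2 e by [].
  transitivity ((mu \x mu)%E (ball p.1.1 e `*` ball p.1.2 e) * mu (ball p.2 e))%E.
    by apply: product_measure1E; [apply: measurableX|]; exact: mB.
  have -> // : (mu \x mu)%E (ball p.1.1 e `*` ball p.1.2 e) =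
    (mu (ball p.1.1 e) * mu (ball p.1.2 e))%E.
    by apply: product_measure1E; exact: mB.
by rewrite !lebesgue_measure_ball ?ltW// !mule_gt0// lte_fin mulrn_wgt0.
Qed.

Lemma supp_in_compact U C f : compact C -> C `<=` U ->
  (forall p, ~ C p -> f p = 0) -> compact (supp_in U f).
Proof.
move=> cC CU fC.
have clC : closed C by apply: compact_closed => //; exact: norm_hausdorff.
have sC : closure (U `&` [set p | f p != 0]) `<=` C.
  rewrite ((closure_id C).1 clC); apply: closure_subset => p [_ /= fp].
  by apply: contrapT => /fC fp0; rewrite fp0 eqxx in fp.
have -> : supp_in U f = closure (U `&` [set p | f p != 0]).
  by apply: setIidr => p /sC /CU.
by apply: subclosed_compact cC sC; exact: closed_closure.
Qed.

(** A polynomial, positive exactly in the open Euclidean ball; composing [flat 0] with it gives a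
    smooth bump function. *)
Definition bump_arg (c : E) (r : R) p : R :=
  r ^+ 2 - (cx p - cx c) ^+ 2 - (cy p - cy c) ^+ 2 - (cz p - cz c) ^+ 2.

Lemma smooth_bump_arg U c r : open U -> smooth_on U (bump_arg c r).
Proof.
move=> oU; rewrite /bump_arg.
have sq (k : E -> R) a : (forall p, is_diff p k k) ->
    smooth_on U (fun p => - (k p - a) ^+ 2).
  move=> dk; have sk : smooth_on U (fun p => k p + - a).
    by apply: smoothD => //; [exact: smooth_coord|exact: smooth_cst].
  by apply: smoothN => //; exact: (smoothM oU sk sk).
apply: smoothD => //; last exact/sq/is_diff_cz.
apply: smoothD => //; last exact/sq/is_diff_cy.
apply: smoothD => //; last exact/sq/is_diff_cx.
exact: smooth_cst.
Qed.

Lemma bump_arg_ge0 c r p : 0 <= r -> 0 <= bump_arg c r p ->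
  [/\ `|cx p - cx c| <= r, `|cy p - cy c| <= r & `|cz p - cz c| <= r].
Proof.
move=> r0; rewrite /bump_arg => q0.
have sq (a : R) : a ^+ 2 <= r ^+ 2 -> `|a| <= r.
  by rewrite -[a ^+ 2](real_normK (num_real a)) ler_sqr.
move: q0; set a := cx p - _; set b := cy p - _; set d := cz p - _ => q0.
by split; apply: sq; have := sqr_ge0 a; have := sqr_ge0 b; have := sqr_ge0 d; lra.
Qed.

Lemma bump_compact c r : 0 <= r -> compact [set p | 0 <= bump_arg c r p].
Proof.
move=> r0.
pose I (x : R) := [set` `[x - r, x + r]].
have cI : compact (I (cx c) `*` I (cy c) `*` I (cz c)).
  by do 2 ?apply: compact_setX => //; exact: segment_compact.
apply: subclosed_compact cI _.
  have cq : continuous (bump_arg c r).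
    apply: smooth_continuous; apply: smooth_bump_arg; exact: openT.
  have -> : [set p | 0 <= bump_arg c r p] =
    bump_arg c r @^-1` [set x | 0 <= x] by [].
  by apply: closed_comp => [p _|]; [exact: cq|exact: closed_ge].
by move=> [[x y] z] /= /(bump_arg_ge0 r0)[]; rewrite !ler_distl => hx hy hz;
  split; [split|]; rewrite /I /= in_itv.
Qed.

(** Testing against [(A - B) b] with [b] a bump function at a point where
    [A] and [B] differ. *)
Lemma fundamental_lemma U A B : open U -> smooth_on U A -> smooth_on U B ->
  (forall f, test_fun U f -> pairing U A f = pairing U B f) ->
  {in U, A =1 B}.
Proof.
move=> oU sA sB AB p0; rewrite inE => Up0.
apply: contrapT => /eqP; rewrite -subr_eq0.
set D := fun p => A p - B p; rewrite -/(D p0) => D0.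
have sD : smooth_on U D by apply: smoothD => //; exact: smoothN.
have /nbhs_ballP[/= e e0 eU] : nbhs p0 U by exact: open_nbhs_nbhs.
(* Halving keeps the closed Euclidean ball carrying the bump inside the open ball of radius [e],
   hence inside [U]. *)
pose r := e / 2; have r0 : 0 < r by rewrite divr_gt0.
pose q := bump_arg p0 r; pose C := [set p | 0 <= q p].
have cC : compact C by apply: bump_compact; exact: ltW.
have CU : C `<=` U.
  move=> p /(bump_arg_ge0 (ltW r0))[hx hy hz]; apply: eU.
  have re : r < e by rewrite /r ltr_pdivrMr// mulr_natr mulr2n ltrDl.
  by split; [split|]; rewrite /ball /= distrC; apply: le_lt_trans re.
have sq : smooth_on U q by exact: smooth_bump_arg.
have sb : smooth_on U (flat 0 \o q).
  by apply: smooth_gen_smooth => //; apply/sg_flat/sg_smooth.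
pose b p := flat 0 (q p).
have b0 p : ~ C p -> b p = 0.
  by move=> /negP; rewrite -ltNge => /ltW; exact: flat_le0.
pose f p := D p * b p.
have sf : smooth_on U f by exact: smoothM.
have f0 p : ~ C p -> f p = 0 by move=> /b0 bp; rewrite /f bp mulr0.
have tf : test_fun U f by split => //; exact: supp_in_compact f0.
have sDf : smooth_on U (fun p => D p * f p) by exact: smoothM.
have int0 g : smooth_on U g -> leb3.-integrable U (EFin \o (fun p => g p * f p)).
  move=> sg; apply: (@supp_integrable _ U C) => //; first exact: smoothM.
  by move=> p _ /f0 ->; rewrite mulr0.
have mU := open_measurable3 oU.
have DfI : \int[leb3]_(p in U) (D p * f p) = 0.
  have := AB f tf; rewrite /pairing !int_dmuE => /eqP.
  rewrite -subr_eq0 -RintegralB//; [|exact: int0|exact: int0].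
  move=> /eqP <-; apply: eq_Rintegral => p _; rewrite /D mulrBl//.
(* The integrand is [D ^+ 2] times the bump, so its zero integral is also that of its absolute
   value, and it vanishes almost everywhere on [U]. *)
have Dfge p : 0 <= D p * f p.
  by rewrite /f mulrA -expr2 mulr_ge0 ?sqr_ge0// flat_ge0.
have IDf := int0 _ sD.
have : (\int[leb3]_(p in U) `|(D p * f p)%:E| = 0)%E.
  have := DfI; rewrite /Rintegral => h.
  under eq_integral => p _ do rewrite gee0_abs ?lee_fin//.
  rewrite -[LHS]fineK ?h//.
  exact: integrable_fin_num.
move/(@ae_eq_integral_abs _ _ _ ((mu \x mu) \x mu)%E U mU).
move=> /(_ (measurable_int _ IDf)).
move=> [N [mN N0 DN]].
have near_pos : \forall p \near p0, U p /\ D p * f p != 0.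
  have cD := differentiable_continuous (smooth_diff sD Up0).
  have cq := differentiable_continuous (smooth_diff sq Up0).
  near=> p; split.
    near: p; exact: open_nbhs_nbhs.
  have Dp : D p != 0 by near: p; exact: (cvgr_neq0 _ cD).
  have qp : 0 < q p.
    near: p; apply: (cvgr_gt _ cq).
    by rewrite /q /bump_arg !subrr !expr0n /= !subr0 exprn_gt0.
  by rewrite /f !mulf_neq0// gt_eqF// flat_gt0.
have /nbhs_ballP[/= e' e'0 e'N] := near_pos.
(* By continuity the integrand is nonzero on this ball, which therefore lies in the null set [N]. *)
have : (leb3 (ball p0 e') <= 0)%E.
  rewrite -N0; apply: le_measure; rewrite ?inE//.
    by apply: open_measurable3; exact: ball_open.
  move=> p /e'N[Up /eqP Dfp]; apply: DN => /= /(_ Up) [].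
  exact: Dfp.
by rewrite leNgt ball3_measure_gt0.
Unshelve. all: by end_near. Qed.
End Fundamental.

(** * Identification of the functional derivative and of the coadjoint action *)

Section Coadjoint.
Context {R : realType}.
Local Notation E := ((R * R) * R)%type.
Local Notation mu := (@lebesgue_measure R).
Variable U : set E.
Hypothesis oU : open U.
Implicit Types (f g H K L A : E -> R) (p : E).

Lemma eq_int_dmu f g : {in U, f =1 g} -> int_dmu U f = int_dmu U g.
Proof. by move=> fg; rewrite !int_dmuE; exact: eq_Rintegral. Qed.

(** Lets the chosen functional derivatives, determined on [U] only, be replaced inside the
    Lie--Poisson bracket. *)
Lemma eq_bracket_c H H' K K' : {in U, H =1 H'} -> {in U, K =1 K'} ->
  {in U, bracket_c H K =1 bracket_c H' K'}.
Proof.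
move=> HH KK p pU.
have eqp i f g : {in U, f =1 g} -> partial i f p = partial i g p.
  by move=> fg; exact: (eq_on_partial i oU fg pU).
have eqx f g : {in U, f =1 g} -> dx f p = dx g p by exact: (@eqp 0).
have eqy f g : {in U, f =1 g} -> dy f p = dy g p by exact: (@eqp 1).
have eqz f g : {in U, f =1 g} -> dz f p = dz g p by exact: (@eqp ord_max).
rewrite /bracket_c (eqx _ _ HH) (eqx _ _ KK) (eqy _ _ HH) (eqy _ _ KK).
by rewrite (eqz _ _ HH) (eqz _ _ KK) (HH _ pU) (KK _ pU).
Qed.

(** The chosen function and [K] both represent the derivative at 0 of the same real function for
    every test variation, so their pairings with test functions coincide. *)
Lemma fderivE F L K : is_fderiv U F L K -> {in U, fderiv U F L =1 K}.
Proof.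
move=> FK.
have [sK' FK'] : is_fderiv U F L (fderiv U F L).
  exact: (@getPex _ [set K | is_fderiv U F L K] (ex_intro _ _ FK)).
have [sK {}FK] := FK.
apply: fundamental_lemma => // f tf.
by have d1 := FK _ tf; have d2 := FK' _ tf; rewrite -(@derive_val _ _ _ _ _ _ _ d1)
  -(@derive_val _ _ _ _ _ _ _ d2).
Qed.

Definition coad_expr K L p : R :=
  bracket_c L K p + 2 * div_dmu (contact_vf K) p * L p.

Lemma coad_exprE K L p : smooth_on U K -> U p ->
  coad_expr K L p = bracket_c L K p - 4 * dz K p * L p.
Proof. by move=> sK Up; rewrite /coad_expr (div_contact_vf oU)//; ring. Qed.

(** On [U] the candidate is [- J_LP L K]; integrating by parts against [H] gives minus the integral
    of [L {H, K}_c], and antisymmetry of the bracket absorbs the sign. The compact support comes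
    from [H]. *)
Lemma is_coad_expr K L : smooth_on U K -> smooth_on U L ->
  is_coad U K L (coad_expr K L).
Proof.
move=> sK sL; split.
  apply: (@smooth_eq _ _ (fun p => bracket_c L K p + - (4 * dz K p * L p))) => //.
    apply: smoothD => //; first exact: smooth_bracket.
    apply: smoothN => //; apply: smoothM => //; apply: smoothM => //.
      exact: smooth_cst.
    exact: smooth_dz.
  by move=> p; rewrite inE => Up; rewrite coad_exprE.
move=> H [sH cH].
have parts : int_dmu U (fun p => L p * bracket_c H K p) =
    int_dmu U (fun p => H p * J_LP L K p).
  by apply: (by_parts oU cH) => // [p []//|p Up Hp]; constructor 1.
have HU : supp_in U H `<=` U by move=> p [].
have mU := open_measurable3 oU.
(* Linearity of the real-valued integral asks for integrability, supplied here by the compact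
   support of [H]. *)
have opp f : smooth_on U f -> (forall p, U p -> ~ supp_in U H p -> f p = 0) ->
    int_dmu U (fun p => - f p) = - int_dmu U f.
  move=> sf f0; have If := supp_integrable oU cH HU sf f0.
  rewrite !int_dmuE -mulN1r.
  rewrite -(@RintegralZl _ _ _ ((mu \x mu) \x mu)%E U f (-1) mU If).
  by apply: eq_Rintegral => p _; rewrite mulN1r.
rewrite /pairing.
transitivity (int_dmu U (fun p => - (H p * J_LP L K p))).
  apply: eq_int_dmu => p; rewrite inE => Up; rewrite coad_exprE//.
  rewrite J_LPE; last exact: smooth_diff sK Up.
  by rewrite /bracket_c /contact_x /contact_y /contact_z; ring.
transitivity (int_dmu U (fun p => - (L p * bracket_c H K p))); last first.
  by apply: eq_int_dmu => p _; rewrite /bracket_c; ring.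
rewrite !opp ?parts//.
- by apply: smoothM => //; exact: smooth_bracket.
- move=> p Up /(supp_in_vanish oU Up)[h0 h1].
  rewrite /bracket_c h0 (h1 0 : dx H p = 0) (h1 1 : dy H p = 0).
  by rewrite (h1 ord_max : dz H p = 0); ring.
- by apply: smoothM => //; exact: smooth_J_LP.
- by move=> p Up /(supp_in_vanish oU Up)[-> _]; rewrite mul0r.
Qed.

Lemma is_coad_coad K L : smooth_on U K -> smooth_on U L ->
  is_coad U K L (coad U K L).
Proof.
move=> sK sL.
exact: (@getPex _ [set A | is_coad U K L A] (ex_intro _ _ (is_coad_expr sK sL))).
Qed.

Lemma coadE K L : smooth_on U K -> smooth_on U L ->
  {in U, coad U K L =1 coad_expr K L}.
Proof.
move=> sK sL; have [s1 c1] := is_coad_coad sK sL.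
have [s2 c2] := is_coad_expr sK sL.
by apply: fundamental_lemma => // f tf; rewrite c1// c2.
Qed.

End Coadjoint.

Theorem proposition6 (R : realType) (U : set ((R * R) * R)%type)
    (openU : open U) :
  [/\ (* J_LP is the Hamiltonian operator of the Lie--Poisson bracket *)
      (forall H K L : (R * R) * R -> R,
        smooth_on U H -> smooth_on U K -> smooth_on U L ->
        compact (supp_in U H `&` supp_in U K `&` supp_in U L) ->
        int_dmu U (fun p => L p * bracket_c H K p)
          = int_dmu U (fun p => H p * J_LP L K p)),
      (forall (FH FK : ((R * R) * R -> R) -> R) (H K L : (R * R) * R -> R),
        smooth_on U L -> is_fderiv U FH L H -> is_fderiv U FK L K ->
        compact (supp_in U H `&` supp_in U K `&` supp_in U L) ->
        LP_bracket U FH FK L = int_dmu U (fun p => H p * J_LP L K p)),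
      (* the coadjoint action, for each K and L *)
      (forall K L : (R * R) * R -> R,
        smooth_on U K -> smooth_on U L ->
        is_coad U K L (coad U K L) /\
        forall p, U p ->
          coad U K L p
            = bracket_c L K p + 2 * div_dmu (contact_vf K) p * L p)
    & (* the Lie--Poisson equation, for a curve L in Den(M) over times I *)
      (forall (FK : ((R * R) * R -> R) -> R) (I : set R)
          (L K : R -> (R * R) * R -> R),
        (forall t, I t -> smooth_on U (L t)) ->
        (forall t, I t -> is_fderiv U FK (L t) (K t)) ->
        (forall t p, I t -> U p ->
           is_derive t 1 (fun s => L s p) (- coad U (K t) (L t) p))
        <->
        (forall t p, I t -> U p ->
           is_derive t 1 (fun s => L s p)
             (- bracket_c (L t) (K t) p
              - 2 * div_dmu (contact_vf (K t)) p * L t p)))].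
Proof.
have part1 H K L : smooth_on U H -> smooth_on U K -> smooth_on U L ->
    compact (supp_in U H `&` supp_in U K `&` supp_in U L) ->
    int_dmu U (fun p => L p * bracket_c H K p)
      = int_dmu U (fun p => H p * J_LP L K p).
  move=> sH sK sL cC; apply: (by_parts openU cC) => // [p [[[]]]//|p Up nC].
  have [hH|] := pselect (supp_in U H p); last by constructor 1.
  have [hK|] := pselect (supp_in U K p); last by constructor 2.
  by constructor 3 => hL; exact: nC.
have coadP K L p : smooth_on U K -> smooth_on U L -> U p ->
    coad U K L p = bracket_c L K p + 2 * div_dmu (contact_vf K) p * L p.
  by move=> sK sL Up; apply: (coadE openU sK sL); rewrite inE.
split => //.
- move=> FH FK H K L sL dH dK cC.
  rewrite -(part1 H K L dH.1 dK.1 sL cC); apply: eq_int_dmu => p pU.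
  by rewrite (eq_bracket_c openU (fderivE openU dH) (fderivE openU dK) pU).
- move=> K L sK sL; split; first exact: is_coad_coad.
  by move=> p; exact: coadP.
- move=> FK I L K sL dK.
  have E t p : I t -> U p -> - coad U (K t) (L t) p =
      - bracket_c (L t) (K t) p - 2 * div_dmu (contact_vf (K t)) p * L t p.
    move=> It Up; rewrite coadP//; [|exact: (dK _ It).1|exact: sL].
    by rewrite opprD.
  by split => dL t p It Up; have := dL t p It Up; rewrite E.
Qed.
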